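(* Let $E$ be a Banach space, let $\mathcal F=\{f_n\}_{n\in\mathbb N}\subset E^*$ be a countable norming subset for $E$ generating the separable isometric predual $E_*=\mathrm{cl}_{E^*}(\mathrm{span}\,\mathcal F)$ of $E$, and let $C\subset\ell^\infty$ be an isometric predual of $\ell^1$. Let $V:E\to\ell^\infty$, $V(x)=\{\langle f_n,x\rangle_E\}_{n\in\mathbb N}$, and $E_C=\{x\in E: V(x)\in C\}$. Then the condition $$\text{(AP)}\qquad \forall x\in E\ \ \exists \{y_j\}_{j\in\mathbb N}\subset E_C:\quad y_j\to x \text{ in } \sigma(E,\mathcal F),\qquad \sup_{j\in\mathbb N}\|y_j\|_E<+\infty$$ holds if and only if $(E_C)^*\cong E_*$ via the duality pairing $\langle\psi,y\rangle_{E_C}=\langle y,\psi\rangle_{E_*}$ for $\psi\in E_*$, $y\in E_C$ (that is, the map sending $\psi\in E_*$ to the functional $y\mapsto\langle y,\psi\rangle_{E_*}$ on $E_C$ is an isometric isomorphism of $E_*$ onto $(E_C)^*$).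
   Context: All Banach spaces are real; $\cong$ denotes isometric isomorphism. $\mathcal F\subset E^*$ is norming for $E$ if $\|x\|_E=\sup_{f\in\mathcal F}|\langle f,x\rangle_E|$ for all $x\in E$. $\sigma(E,\mathcal F)$ is the coarsest topology on $E$ making all elements of $\mathcal F$ continuous. That $\mathcal F$ generates the isometric predual $E_*=\mathrm{cl}_{E^*}(\mathrm{span}\,\mathcal F)$ means that the canonical map $E\to (E_* )^*$, $x\mapsto(\psi\mapsto\psi(x))$, is an isometric isomorphism (this is the case when the closed unit ball of $E$ is $\sigma(E,\mathcal F)$-compact); thus $\langle x,\psi\rangle_{E_*}=\psi(x)$ for $x\in E$, $\psi\in E_*$. An isometric predual $C$ of $\ell^1$ is a Banach space with $C^*\cong\ell^1$; it is regarded via the canonical embedding as a closed subspace of $C^{**}=\ell^\infty$, so that the map $\ell^1\to C^*$, $\xi\mapsto(c\mapsto\sum_n\xi_nc_n)$, is an isometric isomorphism. $E_C$ carries the norm of $E$. *)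

(* Defs.v *)
From mathcomp Require Import all_boot all_order all_algebra.
From mathcomp Require Import all_classical all_reals all_analysis.

Set Implicit Arguments.
Unset Strict Implicit.
Unset Printing Implicit Defensive.

Import Order.TTheory GRing.Theory Num.Theory.
Import numFieldNormedType.Exports.

Local Open Scope classical_set_scope.
Local Open Scope ring_scope.

(* A normed space that need not be a type of its own (a subspace of E, l^1,
   a dual space, ...) is given by a carrier D : set X inside an lmodType X,
   together with a function N : X -> R whose values on D are the norm.  A
   functional on such a space is a function on all of X of which only the
   values on D are meaningful: two functionals are identified when they agree
   on D. *)

Section NormedSpaces.
Variable R : realType.

Definition linear_subspace (X : lmodType R) (D : set X) : Prop :=
  D 0 /\ forall (a : R) (x y : X), D x -> D y -> D (a *: x + y).

Definition lin_span (X : lmodType R) (A : set X) : set X :=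
  [set x | exists (n : nat) (a : 'I_n -> R) (w : 'I_n -> X),
     (forall i, A (w i)) /\ x = \sum_(i < n) a i *: w i].

Definition norm_closure (X : lmodType R) (N : X -> R) (D A : set X) : set X :=
  [set x | D x /\ forall e : R, 0 < e -> exists2 a, A a & N (x - a) < e].

Definition dual_space (X : lmodType R) (N : X -> R) (D : set X) :
    set (X -> R^o) :=
  [set phi |
     (forall (a : R) (x y : X), D x -> D y ->
        phi (a *: x + y) = a * phi x + phi y) /\
     exists M : R, forall x, D x -> `|phi x| <= M * N x].

Definition dual_norm (X : lmodType R) (N : X -> R) (D : set X)
    (phi : X -> R^o) : R :=
  sup [set `|phi x| | x in [set x | D x /\ N x <= 1]].

(* T is an isometric isomorphism of (A, NA) onto the dual of (D, N); injectivity
   is a consequence of linearity and isometry. *)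
Definition isometric_iso_onto_dual (U X : lmodType R)
    (NA : U -> R) (A : set U) (N : X -> R) (D : set X)
    (T : U -> X -> R^o) : Prop :=
  [/\ forall u, A u -> dual_space N D (T u),
      forall (a : R) (u v : U), A u -> A v -> forall x, D x ->
        T (a *: u + v) x = a * T u x + T v x,
      forall u, A u -> dual_norm N D (T u) = NA u &
      forall phi, dual_space N D phi ->
        exists2 u, A u & forall x, D x -> T u x = phi x].

End NormedSpaces.

Section SequenceSpaces.
Variable R : realType.

Definition linf_space : set (nat -> R^o) :=
  [set u | has_ubound (range (fun n => `|u n|))].

Definition linf_norm (u : nat -> R^o) : R := sup (range (fun n => `|u n|)).

Definition l1_space : set (nat -> R^o) :=
  [set xi | cvgn (series (fun n => `|xi n| : R))].

Definition l1_norm (xi : nat -> R^o) : R :=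
  limn (series (fun n => `|xi n| : R)).

Definition l1_pairing (xi c : nat -> R^o) : R^o :=
  limn (series (fun n => xi n * c n : R)).

Definition isometric_predual_l1 (C : set (nat -> R^o)) : Prop :=
  [/\ C `<=` linf_space,
      linear_subspace C,
      norm_closure linf_norm linf_space C `<=` C &
      isometric_iso_onto_dual l1_norm l1_space linf_norm C l1_pairing].

End SequenceSpaces.

Section Preduals.
Variables (R : realType) (E : normedModType R).

Definition topological_dual : set (E -> R^o) :=
  dual_space (fun x : E => `|x|) setT.

Definition topological_dual_norm : (E -> R^o) -> R :=
  dual_norm (fun x : E => `|x|) setT.

Variable f : nat -> E -> R^o.

(* boundedness is explicit because sup of an unbounded set is 0 *)
Definition norming : Prop :=
  forall x : E, has_ubound (range (fun n => `|f n x|)) /\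
    `|x| = sup (range (fun n => `|f n x|)).

(* sigma(E, {f_n}): E retopologized by the join of the initial topologies
   of the f_n *)
Definition sigma_topology : topologicalType :=
  sup_topology (fun n : nat => Topological.on (initial_topology (f n))).

Definition closed_span : set (E -> R^o) :=
  norm_closure topological_dual_norm topological_dual (lin_span (range f)).

Definition generates_predual : Prop :=
  isometric_iso_onto_dual (fun x : E => `|x|) setT
    topological_dual_norm closed_span
    (fun (x : E) (psi : E -> R^o) => psi x).

Definition coord_map (x : E) : nat -> R^o := fun n => f n x.

Definition E_sub (C : set (nat -> R^o)) : set E := coord_map @^-1` C.

Definition approximation_property (C : set (nat -> R^o)) : Prop :=
  forall x : E, exists y : nat -> E,
    [/\ forall j, E_sub C (y j),
        ((y : nat -> sigma_topology) @ \oo --> (x : sigma_topology)) &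
        has_ubound (range (fun j => `|y j|))].

End Preduals.

(* Main.v *)
Require Import Defs.
From mathcomp Require Import all_boot all_order all_algebra.
From mathcomp Require Import all_classical all_reals all_analysis.
From mathcomp Require Import ring lra.
Import Order.TTheory GRing.Theory Num.Theory.
Import numFieldNormedType.Exports.
Local Open Scope classical_set_scope.
Local Open Scope ring_scope.

Set Implicit Arguments.
Unset Strict Implicit.

(** Since [f] is norming, [coord_map f] embeds [E] isometrically into l^oo and
    [E_C] into [C].

    Suppose first that (AP) holds.  A functional [phi] on [E_C] is transported
    to [coord_map f @` E_C], extended to [C] by Hahn-Banach without increasing
    its norm, and represented there by some [xi] in l^1, because the dual of
    [C] is l^1.  Thus [phi] is the restriction of [psi = \sum_n xi_n f_n], and
    [l1_norm xi <= |phi|] ([E_sub_dual_l1]).  Such a [psi] lies in the closed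
    span of the [f_n] and its norm on [E] is at most [l1_norm xi]; this already
    gives surjectivity.  For the isometry, start from [psi] in the closed span,
    restrict it to [E_C], and let [psi'] be the functional so produced from the
    restriction.  Elements of the closed span are continuous along bounded
    sigma-convergent sequences ([closed_span_cvg]), so by (AP) they are
    determined by their values on [E_C]
    ([approximation_closed_span_eq]); hence [psi' = psi] and
    [|psi| <= l1_norm xi <= |psi restricted to E_C| <= |psi|].  The bound
    in (AP) may depend on [x] in any way: it is used only to pass to
    the limit.

    Conversely, suppose that restriction to [E_C] is isometric on the closed
    span.  Then every [x] can be approximated on finitely many [f_i] by
    elements of [E_C] of norm at most [|x|] ([helly]): otherwise a linear form
    on R^n strictly separates [(f_i x)_i] from the image of the ball of radius
    [|x|] of [E_C], and the corresponding combination of the [f_i] would have a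
    norm on [E_C] strictly smaller than its norm on [E].  Approximating on the
    first [j] functionals with precision [1 / (j + 1)] gives (AP), with bound
    [|x|]. *)

(** * Subspaces and the Hahn-Banach theorem *)

Section Subspaces.
Context {R : realType} {X : lmodType R} {D : set X} (D_lin : linear_subspace D).

Lemma subspaceD x y : D x -> D y -> D (x + y).
Proof. by move=> Dx Dy; rewrite -[x]scale1r; apply: D_lin.2. Qed.

Lemma subspaceZ a x : D x -> D (a *: x).
Proof. by move=> Dx; rewrite -[_ *: _]addr0; apply: D_lin.2 => //; exact: D_lin.1. Qed.

Lemma subspaceB x y : D x -> D y -> D (x - y).
Proof. by move=> Dx Dy; rewrite -scaleN1r; apply: subspaceD => //; exact: subspaceZ. Qed.

Lemma subspace_sum n (a : 'I_n -> R) (w : 'I_n -> X) :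
  (forall i, D (w i)) -> D (\sum_(i < n) a i *: w i).
Proof.
move=> Dw; elim/big_ind: _ => [|x y Dx Dy|i _].
- exact: D_lin.1.
- exact: subspaceD.
- exact: subspaceZ.
Qed.

End Subspaces.

Definition seminorm_on {R : realType} {X : lmodType R} (D : set X) (p : X -> R) :=
  (forall a x, D x -> p (a *: x) = `|a| * p x) /\
  (forall x y, D x -> D y -> p (x + y) <= p x + p y).

Section HahnBanach.
Context {R : realType} {X : lmodType R} (D : set X) (p : X -> R).
Hypotheses (D_lin : linear_subspace D) (p_semi : seminorm_on D p).

(** A functional on a subspace of [D] bounded by [p], seen as its graph.
    Single-valuedness follows from linearity and the bound
    ([dominated_graph_fun]), so that unions of chains are immediate and a
    functional can be given on the image of a map without inverting that
    map. *)
Definition dominated_graph (G : set (X * R^o)) : Prop :=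
  linear_subspace G /\ forall z, G z -> D z.1 /\ (z.2 : R) <= p z.1.

Lemma seminorm_on0 : p 0 = 0.
Proof. by rewrite -(scale0r 0) p_semi.1 ?normr0 ?mul0r //; exact: D_lin.1. Qed.

Lemma dominated_graph0 G v : dominated_graph G -> G (0, v) -> v = 0 :> R.
Proof.
move=> [Gl Gd] Gv; apply/eqP; rewrite eq_le.
have /Gd[_ /=] := Gv; rewrite seminorm_on0 => -> /=.
have /Gd[_ /=] : G (-1 *: 0, -1 * v) := subspaceZ Gl (-1) Gv.
by rewrite scaler0 seminorm_on0 mulN1r oppr_le0.
Qed.

Lemma dominated_graph_fun G x v w :
  dominated_graph G -> G (x, v) -> G (x, w) -> v = w :> R.
Proof.
move=> Gg Gv Gw; apply/eqP; rewrite -subr_eq0; apply/eqP.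
apply: (dominated_graph0 Gg).
have := subspaceB Gg.1 Gv Gw; rewrite [(_, _) - _](_ : _ = (x - x, v - w)) //.
by rewrite subrr.
Qed.

(** The value [c] at the new vector [x] must satisfy
    [z.2 - p (z.1 - x) <= c <= p (w.1 + x) - w.2] for all [z, w] in [G]; the
    triangle inequality for [p] makes every left-hand side at most every
    right-hand side, so the supremum of the former will do. *)
Lemma dominated_graph_extend G x : dominated_graph G -> D x ->
  exists2 G', dominated_graph G' & G `<=` G' /\ exists c, G' (x, c).
Proof.
move=> [Gl Gd] Dx.
pose A : set R := [set z.2 - p (z.1 - x) | z in G].
have Aub w : G w -> ubound A (p (w.1 + x) - w.2).
  move=> Gw _ [z Gz <-]; have /Gd[_ /=] := subspaceD Gl Gz Gw.
  have [[Dz _] [Dw _]] := (Gd _ Gz, Gd _ Gw).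
  have := p_semi.2 _ _ (subspaceB D_lin Dz Dx) (subspaceD D_lin Dw Dx).
  by rewrite addrACA [- x + _]addrC subrr addr0; lra.
have A0 : A !=set0 by exists ((0 : X * R^o).2 - p ((0 : X * R^o).1 - x)), 0 => //; exact: Gl.1.
have Ahub : has_ubound A by exists (p (0 + x) - 0); apply: (Aub 0); exact: Gl.1.
pose c := sup A.
have c_ge z : G z -> z.2 - p (z.1 - x) <= c by move=> Gz; apply: ub_le_sup => //; exists z.
have c_le z : G z -> c <= p (z.1 + x) - z.2 by move=> Gz; apply: ge_sup => //; exact: Aub.
pose G' : set (X * R^o) := [set z | exists w t, G w /\ z = w + t *: (x, c)].
exists G'; last first.
  split=> [z Gz|]; first by exists z, 0; rewrite scale0r addr0.
  by exists c, 0, 1; split; [exact: Gl.1|rewrite scale1r add0r].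
split; first split.
- by exists 0, 0; split; [exact: Gl.1|rewrite scale0r addr0].
- move=> a _ _ [w [t [Gw ->]]] [w' [t' [Gw' ->]]].
  exists (a *: w + w'), (a * t + t'); split; first exact: Gl.2.
  by rewrite scalerDr scalerDl addrACA scalerA.
- move=> _ [[y v] [t [Gw ->]]].
  have [Dy vy] := Gd _ Gw; rewrite /= in Dy vy.
  split; first by apply: subspaceD => //; exact: subspaceZ.
  rewrite /= -[t *: c]/(t * c).
  have [t0|t0|->] := ltgtP t 0; last first.
  + by rewrite scale0r addr0 mul0r addr0.
  + have := c_le _ (subspaceZ Gl t^-1 Gw); rewrite /= => h.
    have -> : y + t *: x = t *: (t^-1 *: y + x).
      by rewrite scalerDr scalerA divff ?gt_eqF // scale1r.
    rewrite p_semi.1; last by apply: subspaceD => //; exact: subspaceZ.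
    rewrite gtr0_norm // -(ler_pM2l t0) mulrBr in h *.
    move: h; rewrite mulrA divff ?gt_eqF // mul1r; lra.
  + pose s := - t; have s0 : 0 < s by rewrite oppr_gt0.
    have := c_ge _ (subspaceZ Gl s^-1 Gw); rewrite /= => h.
    have -> : y + t *: x = s *: (s^-1 *: y - x).
      by rewrite scalerBr scalerA divff ?gt_eqF // scale1r scaleNr opprK.
    rewrite p_semi.1; last by apply: subspaceB => //; exact: subspaceZ.
    rewrite gtr0_norm // -(ler_pM2l s0) mulrBr in h *.
    move: h; rewrite mulrA divff ?gt_eqF // mul1r /s; lra.
Qed.

(** Hahn-Banach for a seminorm that is only meaningful on a subspace [D], by
    Zorn's lemma on dominated graphs. *)
Theorem hahn_banach_graph G0 : dominated_graph G0 ->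
  exists Phi : X -> R^o,
  [/\ forall a x y, D x -> D y -> Phi (a *: x + y) = a * Phi x + Phi y,
      forall x, D x -> `|Phi x| <= p x &
      forall z, G0 z -> Phi z.1 = z.2].
Proof.
move=> G0g.
(* Adjoining [G0] to every member of a chain, rather than asking each member
   to contain it, also covers the empty chain. *)
have [|M [Mg Mmax]] := @Zorn_bigcup _ [set G | dominated_graph (G `|` G0)].
  move=> F FP Ftot; split; first split.
  - by right; exact: G0g.1.1.
  - move=> a z w.
    have step H z' w' : F H -> (H `|` G0) z' -> (H `|` G0) w' ->
        (\bigcup_(H in F) H `|` G0) (a *: z' + w').
      move=> FH Hz Hw; have [[_ Hl] _] := FP _ FH.
      by case: (Hl a _ _ Hz Hw) => [?|]; [left; exists H|right].
    move=> [[H FH Hz]|Gz] [[K FK Kw]|Gw].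
    + have [HK|KH] := Ftot _ _ FH FK.
      * by apply: (step K) => //; left => //; exact: HK.
      * by apply: (step H) => //; left => //; exact: KH.
    + by apply: (step H) => //; [left|right].
    + by apply: (step K) => //; [right|left].
    + by right; exact: G0g.1.2.
  - move=> z [[H FH Hz]|Gz]; last exact: G0g.2.
    by apply: (FP _ FH).2; left.
set G := M `|` G0 in Mg.
have tot x : D x -> exists c, G (x, c).
  move=> Dx; have [G' G'g [GG' [c Gc]]] := dominated_graph_extend Mg Dx.
  have G'E : G' `|` G0 = G' by apply/setUidPl => z ?; apply: GG'; right.
  exists c; left; apply: contrapT => nMc.
  apply: (Mmax G'); last by rewrite /= G'E.
  split; first by move=> z Mz; apply: GG'; left.
  by move=> h; apply: nMc; exact: h.
have /choice[Phi PhiP] : forall x, exists v : R^o, D x -> G (x, v).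
  move=> x.
  have [Dx|nDx] := pselect (D x); last by exists 0.
  by have [c Gc] := tot _ Dx; exists c.
have PhiU x v : G (x, v) -> Phi x = v.
  move=> Gv; apply: (dominated_graph_fun Mg _ Gv); apply: PhiP.
  exact: (Mg.2 _ Gv).1.
have Philin a x y : D x -> D y -> Phi (a *: x + y) = a * Phi x + Phi y.
  by move=> Dx Dy; apply: PhiU; exact: (Mg.1.2 a _ _ (PhiP _ Dx) (PhiP _ Dy)).
exists Phi; split=> //.
- move=> x Dx; rewrite ler_norml.
  have [_ /= ->] := Mg.2 _ (PhiP _ Dx); rewrite andbT.
  have [_ /=] := Mg.2 _ (subspaceZ Mg.1 (-1) (PhiP _ Dx)).
  by rewrite p_semi.1 // normrN1 mul1r scaleN1r lerNl.
- by move=> [x v] Gz /=; apply: PhiU; right.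
Qed.

End HahnBanach.

(** * Dual norms *)

Section DualSpaces.
Context {R : realType}.

Lemma dual_norm_le (X : lmodType R) (N : X -> R) (D : set X) (phi : X -> R^o) M :
  D 0 -> N 0 = 0 -> 0 <= M -> (forall x, D x -> `|phi x| <= M * N x) ->
  dual_norm N D phi <= M.
Proof.
move=> D0 N0 M0 phiM; apply: ge_sup; first by exists `|phi 0|, 0 => //=; rewrite N0 ler01.
by move=> _ [x [Dx Nx] <-]; apply: le_trans (phiM _ Dx) _; rewrite ler_piMr.
Qed.

Lemma dual_space_linear (X : lmodType R) (N : X -> R) (D : set X) :
  (forall x, 0 <= N x) -> linear_subspace (dual_space N D).
Proof.
move=> N0; split; first split.
- by move=> *; rewrite mulr0 addr0.
- by exists 0 => x _; rewrite normr0 mul0r.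
move=> a phi psi [phiL [M phiM]] [psiL [K psiK]]; split.
- move=> b x y Dx Dy /=.
  rewrite -[LHS]/(a * phi (b *: x + y) + psi (b *: x + y)).
  rewrite -[RHS]/(b * (a * phi x + psi x) + (a * phi y + psi y)).
  by rewrite phiL // psiL //; ring.
- exists (`|a| * M + K) => x Dx; rewrite -[X in `|X|]/(a * phi x + psi x).
  rewrite mulrDl -mulrA (le_trans (ler_normD _ _)) // lerD ?psiK // normrM.
  by rewrite ler_wpM2l ?phiM.
Qed.

Lemma dual_space_setT_sub (X : lmodType R) (N : X -> R) (D : set X) :
  dual_space N setT `<=` dual_space N D.
Proof.
move=> phi [phiL [M phiM]].
by split=> [a x y _ _|]; [exact: phiL|exists M => x _; exact: phiM].
Qed.

Context {E : normedModType R} (D : set E) (D_lin : linear_subspace D).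

Lemma dual_spaceZ (phi : E -> R^o) a x : dual_space (fun x => `|x|) D phi -> D x ->
  phi (a *: x) = a * phi x.
Proof.
move=> [phiL _] Dx; have D0 := D_lin.1.
have := phiL 1 0 0 D0 D0; rewrite scaler0 addr0 mul1r => phi0.
have := phiL a x 0 Dx D0; rewrite !addr0 => ->.
by rewrite -[phi 0](addrK (phi 0)) -phi0 subrr addr0.
Qed.

Lemma le_dual_norm_ball (phi : E -> R^o) x :
  dual_space (fun x => `|x|) D phi -> D x -> `|x| <= 1 ->
  `|phi x| <= dual_norm (fun x => `|x|) D phi.
Proof.
move=> [_ [M phiM]] Dx x1; apply: ub_le_sup; last by exists x.
exists `|M| => _ [y [Dy y1] <-]; apply: (le_trans (phiM _ Dy)).
by rewrite (le_trans (ler_wpM2r _ (ler_norm M))) // ler_piMr.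
Qed.

Lemma dual_norm_ge0 (phi : E -> R^o) : dual_space (fun x => `|x|) D phi ->
  0 <= dual_norm (fun x => `|x|) D phi.
Proof.
move=> phiD; apply: le_trans (normr_ge0 (phi 0)) _.
by apply: le_dual_norm_ball => //; [exact: D_lin.1|rewrite normr0].
Qed.

Lemma le_dual_norm (phi : E -> R^o) x : dual_space (fun x => `|x|) D phi -> D x ->
  `|phi x| <= dual_norm (fun x => `|x|) D phi * `|x|.
Proof.
move=> phiD Dx; have [->|x0] := eqVneq x 0.
  have := dual_spaceZ 0 phiD D_lin.1.
  by rewrite scale0r mul0r => ->; rewrite !normr0 mulr0.
have xp : 0 < `|x| by rewrite normr_gt0.
rewrite -ler_pdivrMr //.
have -> : `|phi x| / `|x| = `|phi (`|x|^-1 *: x)|.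
  by rewrite dual_spaceZ // normrM normfV normr_id mulrC.
apply: le_dual_norm_ball => //; first exact: subspaceZ.
by rewrite normrZ normfV normr_id mulVf ?gt_eqF.
Qed.

End DualSpaces.

(** * The pairing of l^1 with bounded sequences *)

Section Sequences.
Context {R : realType}.
Implicit Types u xi : nat -> R^o.

Lemma le_linf_norm u n : linf_space u -> `|u n| <= linf_norm u.
Proof. by move=> ub; apply: ub_le_sup => //; exists n. Qed.

Lemma linf_norm_le u K : (forall n, `|u n| <= K) -> linf_norm u <= K.
Proof.
by move=> uK; apply: ge_sup => [|_ [n _ <-] //]; exists `|u 0%N|, 0%N.
Qed.

(** Only on bounded sequences: elsewhere [linf_norm] takes the value of [sup]
    on an unbounded set. *)
Lemma linf_norm_seminorm : seminorm_on (@linf_space R) (@linf_norm R).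
Proof.
(* The reverse inequality is this one for the inverse scalar. *)
have scale_le a u : linf_space u -> linf_norm (a *: u) <= `|a| * linf_norm u.
  move=> ub; apply: linf_norm_le => n.
  by rewrite -[X in `|X|]/(a * u n) normrM ler_wpM2l // le_linf_norm.
split=> [a u ub|u v ub vb].
  apply/eqP; rewrite eq_le scale_le //=.
  have [->|a0] := eqVneq a 0.
    rewrite normr0 mul0r; apply: le_trans (normr_ge0 ((0 *: u) 0%N)) _.
    apply: le_linf_norm; exists 0 => _ [n _ <-].
    by rewrite -[X in `|X|]/(0 * u n) mul0r normr0.
  rewrite -ler_pdivlMl ?normr_gt0 // -normfV.
  rewrite -[in leLHS](scale1r u) -(mulVf a0) -scalerA; apply: scale_le.
  case: ub => M uM; exists (`|a| * M) => _ [n _ <-].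
  by rewrite -[X in `|X|]/(a * u n) normrM ler_wpM2l // uM //; exists n.
apply: linf_norm_le => n; rewrite -[X in `|X|]/(u n + v n).
by rewrite (le_trans (ler_normD _ _)) // lerD // le_linf_norm.
Qed.

Lemma l1_pairing_cvg xi u K : l1_space xi -> (forall n, `|u n| <= K) ->
  cvgn (series (fun n => xi n * u n : R)).
Proof.
move=> xi1 uK; apply: normed_cvg.
apply: (@series_le_cvg _ _ (fun n => K * `|xi n|)).
- by move=> n /=.
- by move=> n /=; rewrite mulr_ge0 // (le_trans _ (uK n)).
- by move=> n; rewrite /= normrM mulrC ler_wpM2r.
- exact: is_cvg_seriesZ.
Qed.

(** The tail estimate [|\sum_(i >= N) xi_i u_i| <= K \sum_(i >= N) |xi_i|],
    with the tails written as differences. *)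
Lemma l1_pairing_tail xi u K N : l1_space xi -> (forall n, `|u n| <= K) ->
  `|l1_pairing xi u - \sum_(0 <= i < N) xi i * u i|
    <= (l1_norm xi - \sum_(0 <= i < N) `|xi i|) * K.
Proof.
move=> xi1 uK; have cv := l1_pairing_cvg xi1 uK.
have cvN : (fun n => `|series (fun n => xi n * u n : R) n - \sum_(0 <= i < N) xi i * u i|)
    @ \oo --> `|l1_pairing xi u - \sum_(0 <= i < N) xi i * u i|.
  by apply: cvg_norm; apply: cvgB => //; exact: cvg_cst.
rewrite -(cvg_lim _ cvN) //; apply: limr_le; first by apply/cvg_ex; eexists; exact: cvN.
near=> n; have Nn : (N <= n)%N by near: n; exact: nbhs_infty_ge.
have K0 : 0 <= K by rewrite (le_trans _ (uK 0%N)).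
have : \sum_(0 <= i < n) `|xi i| <= l1_norm xi.
  apply: nondecreasing_cvgn_le => //.
  by apply/nondecreasing_seqP => k; rewrite /series /= big_nat_recr //= lerDl.
rewrite /series /= !(big_cat_nat (leq0n N) Nn) /= addrAC subrr add0r => h.
rewrite (le_trans (ler_norm_sum _ _ _)) //.
rewrite (@le_trans _ _ (\sum_(N <= i < n) `|xi i| * K)) //.
  by apply: ler_sum => i _; rewrite normrM ler_wpM2l.
by rewrite -mulr_suml ler_wpM2r // lerBrDl.
Unshelve. all: by end_near. Qed.

Lemma l1_pairing_le xi u K : l1_space xi -> (forall n, `|u n| <= K) ->
  `|l1_pairing xi u| <= l1_norm xi * K.
Proof. by move=> xi1 uK; have := l1_pairing_tail 0%N xi1 uK; rewrite !big_geq // !subr0. Qed.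

Lemma l1_norm_ge0 xi : l1_space xi -> 0 <= l1_norm xi.
Proof.
by move=> xi1; apply: limr_ge => //; near=> n; exact: sumr_ge0.
Unshelve. all: by end_near. Qed.

End Sequences.

(** * The closed span of a norming sequence *)

Section Predual.
Context {R : realType} {E : normedModType R} (f : nat -> E -> R^o).

Lemma sigma_cvgP (y : nat -> E) (x : E) :
  ((y : nat -> sigma_topology f) @ \oo --> (x : sigma_topology f)) <->
  forall n, (fun j => f n (y j)) @ \oo --> f n x.
Proof.
split=> [/cvg_sup yx n|yx].
  apply: (cvg_comp _ _ (yx n)).
  exact: (@initial_continuous _ _ (f n) x).
apply/cvg_sup => n A; rewrite nbhsE => -[_ [[B Bo <-] Bx] BA].
have nB : nbhs (f n x) B by exact: open_nbhs_nbhs.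
apply: (@filterS _ \oo _ ((fun j => f n (y j)) @^-1` B)); last exact: yx nB.
by move=> j; exact: BA.
Qed.

Hypotheses (f_dual : forall n, topological_dual (f n)) (f_norming : norming f).

Local Notation dual := (@topological_dual R E).
Local Notation dnorm := (@topological_dual_norm R E).

Lemma setT_subspace : linear_subspace [set: E].
Proof. by []. Qed.

Lemma topological_dual_linear : linear_subspace dual.
Proof. exact: dual_space_linear. Qed.

Lemma lin_span_dual : lin_span (range f) `<=` dual.
Proof.
move=> _ [n [a [w [wf ->]]]]; apply: (subspace_sum topological_dual_linear) => i.
by have [k _ <-] := wf i.
Qed.

Lemma coord_le x n : `|f n x| <= `|x|.
Proof. by have [ub ->] := f_norming x; apply: ub_le_sup => //; exists n. Qed.

Lemma coord_mapE a x y :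
  coord_map f (a *: x + y) = a *: coord_map f x + coord_map f y.
Proof. by apply/funext => n; exact: (f_dual n).1. Qed.

Lemma coord_map0 : coord_map f 0 = 0.
Proof.
by apply/funext => n; have := coord_le 0 n; rewrite normr0 normr_le0 => /eqP.
Qed.

Lemma linf_norm_coord x : linf_norm (coord_map f x) = `|x|.
Proof. by rewrite (f_norming x).2. Qed.

(** On a bounded sequence, elements of the span approximate [psi] uniformly,
    and for those convergence is the hypothesis. *)
Lemma closed_span_cvg psi (y : nat -> E) x : closed_span f psi ->
  has_ubound (range (fun j => `|y j|)) ->
  (forall n, (fun j => f n (y j)) @ \oo --> f n x) ->
  (fun j => psi (y j)) @ \oo --> psi x.
Proof.
move=> [psid psia] [K yK] yx; apply/cvgrPdist_lt => e e0.
have {}yK j : `|y j| <= K by apply: yK; exists j.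
have K0 : 0 <= K by rewrite (le_trans _ (yK 0%N)).
(* Replacing [psi] by [g] costs at most [d * (K + `|x|) <= e / 2] in total. *)
pose d := e / (2 * (K + `|x| + 1)).
have d0 : 0 < d by rewrite divr_gt0 // mulr_gt0 // ltr_wpDl // addr_ge0.
have [g gs gd] := psia _ d0.
have gcvg : (fun j => g (y j)) @ \oo --> g x.
  have [n [a [w [wf ->]]]] := gs.
  have sumE z : (\sum_(i < n) a i *: w i) z = \sum_(i < n) a i * w i z.
    by rewrite fct_sumE.
  rewrite sumE; under eq_fun do rewrite sumE.
  apply: cvg_big => [|i _]; first exact: add_continuous.
  apply: cvgM; first exact: cvg_cst.
  by have [k _ <-] := wf i.
have hd : dual (psi - g).
  exact: (subspaceB topological_dual_linear psid (lin_span_dual gs)).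
have h z : `|psi z - g z| <= d * `|z|.
  apply: le_trans (le_dual_norm setT_subspace hd _) _ => //.
  by rewrite ler_wpM2r // ltW.
near=> j.
have gj : `|g x - g (y j)| < e / 2.
  by near: j; apply: cvgr_dist_lt => //; rewrite divr_gt0.
have -> : psi x - psi (y j) = (psi x - g x) + (g x - g (y j)) - (psi (y j) - g (y j)).
  by ring.
rewrite (le_lt_trans (ler_normB _ _)) //.
have h1 := ler_normD (psi x - g x) (g x - g (y j)).
have h2 := h x; have h3 := h (y j).
have h4 : d * `|y j| <= d * K by rewrite ler_wpM2l // ltW.
have h5 : d * `|x| + d * K <= e / 2.
  have -> : e / 2 = d * (K + `|x| + 1).
    by rewrite /d; field; apply: lt0r_neq0; rewrite ltr_wpDl // addr_ge0.
  by rewrite -mulrDr ler_wpM2l ?(ltW d0) // [K + _]addrC lerDl.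
lra.
Unshelve. all: by end_near. Qed.

Lemma approximation_closed_span_eq C psi1 psi2 : approximation_property f C ->
  closed_span f psi1 -> closed_span f psi2 ->
  (forall y, E_sub f C y -> psi1 y = psi2 y) -> psi1 = psi2.
Proof.
move=> AP p1 p2 eq12; apply/funext => x.
have [y [yC /sigma_cvgP yx yb]] := AP x.
have c1 := closed_span_cvg p1 yb yx; have c2 := closed_span_cvg p2 yb yx.
have E12 : (fun j => psi1 (y j)) = (fun j => psi2 (y j)).
  by apply/funext => j; exact: eq12.
by rewrite E12 in c1; apply: cvg_unique c1 c2.
Qed.

Definition l1_functional (xi : nat -> R^o) : E -> R^o :=
  fun x => l1_pairing xi (coord_map f x).

Lemma l1_functional_le xi x : l1_space xi ->
  `|l1_functional xi x| <= l1_norm xi * `|x|.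
Proof. by move=> xi1; apply: l1_pairing_le => // n; exact: coord_le. Qed.

Lemma l1_functional_dual xi : l1_space xi -> dual (l1_functional xi).
Proof.
move=> xi1; split; last by exists (l1_norm xi) => x _; exact: l1_functional_le.
move=> a x y _ _; rewrite /l1_functional /l1_pairing coord_mapE.
have cv z := l1_pairing_cvg xi1 (coord_le z).
have -> : series (fun n => xi n * (a *: coord_map f x + coord_map f y) n : R) =
   (fun n => a * series (fun n => xi n * coord_map f x n : R) n +
             series (fun n => xi n * coord_map f y n : R) n).
  apply/funext => n; rewrite /series /= mulr_sumr -big_split /=.
  apply: eq_bigr => i _.
  rewrite -[(a *: _ + _) i]/(a * coord_map f x i + coord_map f y i); ring.
apply/cvg_lim => //; apply: cvgD; last exact: cv.
by apply: cvgM; [exact: cvg_cst|exact: cv].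
Qed.

(** The partial sums of [\sum_n xi_n f_n] converge in the dual norm, since
    the [f_n] have norm at most 1. *)
Lemma l1_functional_closed_span xi : l1_space xi -> closed_span f (l1_functional xi).
Proof.
move=> xi1; split; first exact: l1_functional_dual.
move=> e e0.
have : series (fun n => `|xi n| : R) @ \oo --> l1_norm xi by [].
move=> /cvgrPdist_lt /(_ e e0) [N _ /(_ N (leqnn N))] /= hN.
have gs : lin_span (range f) (\sum_(i < N) xi i *: f i).
  by exists N, (fun i => xi i), (fun i => f i); split=> // i; exists i.
exists (\sum_(i < N) xi i *: f i) => //.
apply: le_lt_trans hN; apply: dual_norm_le => //; first by rewrite normr0.
move=> x _; rewrite -[X in `|X|]/(l1_functional xi x - (\sum_(i < N) xi i *: f i) x).
rewrite fct_sumE.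
have -> : \sum_(i < N) (xi i *: f i) x = \sum_(0 <= i < N) xi i * coord_map f x i.
  by rewrite big_mkord.
apply: le_trans (l1_pairing_tail N xi1 (coord_le x)) _.
by rewrite ler_wpM2r // ler_norm.
Qed.

(** * Functionals on E_C when (AP) holds *)

Context (C : set (nat -> R^o)) (C_predual : isometric_predual_l1 C).

Lemma E_sub_linear : linear_subspace (E_sub f C).
Proof.
case: C_predual => _ [C0 CL] _ _; split.
  by rewrite /E_sub /= coord_map0.
by move=> a x y Cx Cy; rewrite /E_sub /= coord_mapE; exact: CL.
Qed.

Lemma predual_seminorm : seminorm_on C (@linf_norm R).
Proof.
have [Clinf _ _ _] := C_predual; have [pZ pD] := @linf_norm_seminorm R.
by split=> *; [apply: pZ|apply: pD]; exact: Clinf.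
Qed.

(** Hahn-Banach in [C], for the seminorm [M * linf_norm] with [M] the norm of
    [phi], applied to the graph of [phi] transported by the isometry
    [coord_map f]; the extension is then given by an element of l^1. *)
Lemma E_sub_dual_l1 (phi : E -> R^o) :
  dual_space (fun y : E => `|y|) (E_sub f C) phi ->
  exists xi, [/\ l1_space xi,
    l1_norm xi <= dual_norm (fun y : E => `|y|) (E_sub f C) phi &
    forall y, E_sub f C y -> l1_functional xi y = phi y].
Proof.
move=> phid; have [Clinf Clin _ [_ _ iso surj]] := C_predual.
set M := dual_norm _ _ _; have M0 : 0 <= M := dual_norm_ge0 E_sub_linear phid.
have [linfZ linfD] := predual_seminorm.
pose p (c : nat -> R^o) := M * linf_norm c.
have p_semi : seminorm_on C p.
  split=> [a c Cc|c d Cc Cd]; first by rewrite /p linfZ // mulrCA.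
  by rewrite /p -mulrDr ler_wpM2l // linfD.
pose G := [set (coord_map f y, phi y) | y in E_sub f C].
have G_dom : dominated_graph C p G.
  split; first split.
  - exists 0; first exact: E_sub_linear.1.
    have := dual_spaceZ E_sub_linear 0 phid E_sub_linear.1.
    by rewrite scale0r mul0r coord_map0 => ->.
  - move=> a _ _ [y Cy <-] [z Cz <-]; exists (a *: y + z).
      exact: E_sub_linear.2.
    by rewrite coord_mapE phid.1.
  - move=> _ [y Cy <-]; split=> //=; rewrite /p linf_norm_coord.
    apply: le_trans (ler_norm _) _; exact: (le_dual_norm E_sub_linear phid Cy).
have [Phi [PhiL Phip PhiG]] := hahn_banach_graph Clin p_semi G_dom.
have [|xi xi1 xiP] := surj Phi; first by split=> //; exists M.
exists xi; split=> //.
  rewrite -(iso _ xi1); apply: dual_norm_le => //.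
  - exact: Clin.1.
  - exact: seminorm_on0 Clin predual_seminorm.
  - by move=> c Cc; rewrite xiP //; exact: Phip.
by move=> y Cy; rewrite /l1_functional xiP //; apply: (PhiG (_, _)); exists y.
Qed.

Lemma approximation_isometric_iso : approximation_property f C ->
  isometric_iso_onto_dual dnorm (closed_span f) (fun y : E => `|y|) (E_sub f C)
    (fun psi y => psi y).
Proof.
move=> AP.
have restr psi : closed_span f psi -> dual_space (fun y : E => `|y|) (E_sub f C) psi.
  by move=> [psid _]; exact: (@dual_space_setT_sub _ _ (fun y : E => `|y|)).
split=> // [psi psiS|phi phid].
- have [xi [xi1 xi_le xiP]] := E_sub_dual_l1 (restr _ psiS).
  have psiE : l1_functional xi = psi.
    exact: approximation_closed_span_eq AP (l1_functional_closed_span xi1) psiS xiP.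
  have psid : dual psi := psiS.1.
  apply/eqP; rewrite eq_le; apply/andP; split.
    apply: dual_norm_le; first exact: E_sub_linear.1.
    + by rewrite normr0.
    + exact: (dual_norm_ge0 setT_subspace psid).
    + by move=> y _; exact: (le_dual_norm setT_subspace psid).
  apply: le_trans xi_le; rewrite -psiE; apply: dual_norm_le => //.
  + by rewrite normr0.
  + exact: l1_norm_ge0.
  + by move=> x _; exact: l1_functional_le.
- have [xi [xi1 _ xiP]] := E_sub_dual_l1 phid.
  by exists (l1_functional xi) => //; exact: l1_functional_closed_span.
Qed.

End Predual.

(** * Separation in R^n and Helly's lemma *)

Section Separation.
Context {R : realType} (n : nat).
Implicit Types u v b : 'I_n -> R.

Definition sqdist u v : R := \sum_(i < n) (u i - v i) ^+ 2.

(** If [u0] were the point of [K] nearest to [b], then [b - u0] would separate: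
    [<b - u0, u - u0> <= 0] on [K] while [<b - u0, b - u0> > 0].  As [K] need
    not be closed, [u0] is only nearly nearest; comparing it with
    [u0 + t (u - u0)] for a small [t] still bounds [<b - u0, u - u0>] by half
    of the squared distance [m] from [b] to [K], because [K] is bounded. *)
Lemma separate_point (K : set ('I_n -> R)) b (B d : R) :
  K !=set0 ->
  (forall u v t, K u -> K v -> 0 <= t <= 1 -> K (fun i => u i + t * (v i - u i))) ->
  (forall u v, K u -> K v -> sqdist u v <= B) ->
  0 < d -> (forall u, K u -> d <= sqdist b u) ->
  exists (r : 'I_n -> R) (eta : R), 0 < eta /\
    forall u, K u -> \sum_(i < n) r i * u i <= \sum_(i < n) r i * b i - eta.
Proof.
move=> [k Kk] Kconv KB d0 Kd.
pose Q : set R := [set sqdist b u | u in K].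
have Qlb : has_lbound Q by exists d => _ [u Ku <-]; exact: Kd.
have Q0 : Q !=set0 by exists (sqdist b k), k.
pose m := inf Q.
have dm : d <= m by apply: lb_le_inf => // _ [u Ku <-]; exact: Kd.
have m0 : 0 < m by exact: lt_le_trans dm.
have B0 : 0 <= B by apply: le_trans (KB _ _ Kk Kk); apply: sumr_ge0 => i _; exact: sqr_ge0.
(* Any [t] with [t * B <= m / 2] and [u0] within [t * m / 2] of the infimum
   contribute at most [m / 4] each to the bound on [s] below. *)
have [t [t0 t1 tB]] : exists t : R, [/\ 0 < t, t <= 1 & t * B <= m / 2].
  have p0 : 0 < m + 2 * B by lra.
  exists (m / (m + 2 * B)); split; first exact: divr_gt0.
    by rewrite ler_pdivrMr // mul1r; lra.
  rewrite mulrAC ler_pdivrMr //; nra.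
have e0 : 0 < t * m / 2 by rewrite divr_gt0 // mulr_gt0.
have [_ [u0 Ku0 <-] u0m] := inf_adherent e0 (conj Q0 Qlb).
rewrite -/m in u0m.
exists (fun i => b i - u0 i), (m / 2); split; first by rewrite divr_gt0.
move=> u Ku.
set s := \sum_(i < n) (b i - u0 i) * (u i - u0 i).
have m_le v : K v -> m <= sqdist b v by move=> Kv; apply: ge_inf => //; exists v.
have expand : sqdist b (fun i => u0 i + t * (u i - u0 i)) =
    sqdist b u0 - 2 * t * s + t ^+ 2 * sqdist u u0.
  rewrite /sqdist /s !mulr_sumr -sumrB -big_split /=.
  by apply: eq_bigr => i _; ring.
have h1 : m <= sqdist b u0 - 2 * t * s + t ^+ 2 * sqdist u u0.
  by rewrite -expand; apply: m_le; apply: Kconv => //; rewrite ltW.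
have h2 : t * (t * sqdist u u0) <= t * (m / 2).
  rewrite ler_pM2l //; apply: le_trans tB; rewrite ler_pM2l //; exact: KB.
have h3 : s <= m / 2.
  have : t * (2 * s) <= t * m by move: h1 u0m; rewrite expr2; lra.
  by rewrite ler_pM2l //; lra.
have h4 := m_le _ Ku0.
have -> : \sum_(i < n) (b i - u0 i) * u i =
    \sum_(i < n) (b i - u0 i) * b i - sqdist b u0 + s.
  rewrite /sqdist /s -sumrB -big_split /=.
  by apply: eq_bigr => i _; ring.
lra.
Qed.

End Separation.

Section Helly.
Context {R : realType} {E : normedModType R} (D : set E) (D_lin : linear_subspace D).

(** Finite-dimensional Goldstine theorem, with no loss on the norm: if
    restriction to [D] does not decrease the norm of combinations of the
    [g_i], the ball of [D] of radius [|x|] contains points on which the [g_i]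
    almost agree with their values at [x]. *)
Lemma helly n (g : 'I_n -> E -> R^o) (x : E) (e : R) :
  (forall i, topological_dual (g i)) ->
  (forall a : 'I_n -> R, topological_dual_norm (\sum_(i < n) a i *: g i) <=
     dual_norm (fun y : E => `|y|) D (\sum_(i < n) a i *: g i)) ->
  0 < e ->
  exists2 y, D y & `|y| <= `|x| /\ forall i, `|g i x - g i y| < e.
Proof.
move=> gd gnorm e0; apply: contrapT => nex.
pose G (y : E) : 'I_n -> R := fun i => g i y.
pose K := [set G y | y in [set y | D y /\ `|y| <= `|x|]].
have restr := @dual_space_setT_sub _ _ (fun y : E => `|y|) D.
have g_le i y : `|y| <= `|x| -> `|g i y| <= topological_dual_norm (g i) * `|x|.
  move=> yx; apply: le_trans (le_dual_norm (@setT_subspace R E) (gd i) _) _ => //.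
  by rewrite ler_wpM2l // (dual_norm_ge0 (@setT_subspace R E) (gd i)).
pose B := \sum_(i < n) (2 * (topological_dual_norm (g i) * `|x|)) ^+ 2.
(* A point off by [e] or more in a single coordinate is already at squared
   distance at least [e ^+ 2]. *)
have [|||||r [eta [eta0 rK]]] := @separate_point R n K (G x) B (e ^+ 2).
- by exists (G 0), 0 => //=; split; [exact: D_lin.1|rewrite normr0].
- move=> _ _ t [y [Dy yx] <-] [z [Dz zx] <-] /andP[t0 t1].
  exists ((1 - t) *: y + t *: z).
    split; first by apply: (subspaceD D_lin); exact: subspaceZ.
    apply: le_trans (ler_normD _ _) _; rewrite !normrZ ger0_norm ?subr_ge0 //.
    rewrite (ger0_norm t0).
    have := ler_wpM2l t0 zx; have := @ler_wpM2l _ (1 - t) _ _ _ yx.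
    rewrite subr_ge0 => /(_ t1); lra.
  apply/funext => i; rewrite /G.
  have [gL _] := gd i; rewrite gL //.
  rewrite (dual_spaceZ (@setT_subspace R E) t (gd i)) //; ring.
- move=> _ _ [y [Dy yx] <-] [z [Dz zx] <-]; apply: ler_sum => i _.
  rewrite -(real_normK (num_real (_ - _))) lerXn2r ?nnegrE //.
    by rewrite mulr_ge0 // (le_trans _ (g_le i 0 _)) // normr0.
  apply: le_trans (ler_normB _ _) _.
  have := g_le i _ yx; have := g_le i _ zx; rewrite /G; lra.
- by rewrite exprn_gt0.
- move=> _ [y [Dy yx] <-]; rewrite leNgt; apply/negP => close; apply: nex.
  exists y => //; split=> // i.
  rewrite -(@ltr_pXn2r _ 2) ?nnegrE ?(ltW e0) // real_normK ?num_real //.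
  apply: le_lt_trans close; rewrite /sqdist (bigD1 i) //= lerDl.
  by apply: sumr_ge0 => j _; exact: sqr_ge0.
set psi := \sum_(i < n) r i *: g i in gnorm *.
have psiE y : psi y = \sum_(i < n) r i * g i y by rewrite /psi fct_sumE.
have psid : topological_dual psi.
  exact: (subspace_sum (topological_dual_linear)).
(* The ball is symmetric, so the separation bounds absolute values. *)
have psi_le y : D y -> `|y| <= `|x| -> `|psi y| <= psi x - eta.
  have one z : D z -> `|z| <= `|x| -> psi z <= psi x - eta.
    by move=> Dz zx; rewrite !psiE; apply: (rK (G z)); exists z.
  move=> Dy yx; rewrite ler_norml (one y) // andbT lerNl.
  have := one (-1 *: y) (subspaceZ D_lin _ Dy).
  by rewrite (dual_spaceZ D_lin (-1) (restr _ psid) Dy) mulN1r scaleN1r normrN; apply.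
have [x0|xp] := eqVneq x 0.
  have := psi_le 0 D_lin.1; rewrite normr0 => /(_ (normr_ge0 _)).
  rewrite x0; have := ler_norm (psi 0); lra.
have {}xp : 0 < `|x| by rewrite normr_gt0.
(* So [psi] has norm at most [(psi x - eta) / `|x|] on [D], and hence on [E],
   which contradicts its value at [x]. *)
have nrm : dual_norm (fun y : E => `|y|) D psi <= (psi x - eta) / `|x|.
  have p0 : 0 <= (psi x - eta).
    by apply: le_trans (normr_ge0 _) (psi_le 0 D_lin.1 _); rewrite normr0.
  apply: dual_norm_le; [exact: D_lin.1|by rewrite normr0|by rewrite divr_ge0|].
  move=> y Dy; have [->|y0] := eqVneq y 0.
    have := dual_spaceZ D_lin 0 (restr _ psid) D_lin.1.
    by rewrite scale0r mul0r => ->; rewrite !normr0 mulr0.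
  have yp : 0 < `|y| by rewrite normr_gt0.
  have := psi_le ((`|x| / `|y|) *: y) (subspaceZ D_lin _ Dy).
  rewrite normrZ (dual_spaceZ D_lin _ (restr _ psid) Dy) !normrM !normfV !normr_id.
  rewrite divfK ?gt_eqF // => /(_ (lexx _)).
  by rewrite mulrAC ler_pdivrMr // mulrAC ler_pdivlMr // mulrC.
have := le_dual_norm (@setT_subspace R E) psid (I : [set: E] x).
have := le_trans (gnorm r) nrm; rewrite ler_pdivlMr // => h1 h2.
have := ler_norm (psi x); have := le_trans h2 h1; lra.
Qed.

End Helly.

(** * From the isometry to (AP) *)

Section Converse.
Context {R : realType} {E : normedModType R} (f : nat -> E -> R^o).
Hypotheses (f_dual : forall n, topological_dual (f n)) (f_norming : norming f).
Context (C : set (nat -> R^o)) (C_predual : isometric_predual_l1 C).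

Lemma lin_span_closed_span : lin_span (range f) `<=` closed_span f.
Proof.
move=> g gs; split; first exact: (lin_span_dual f_dual).
move=> e e0; exists g => //; rewrite subrr; apply: le_lt_trans e0.
apply: dual_norm_le => //; first by rewrite normr0.
by move=> x _; rewrite mul0r normr0.
Qed.

Lemma isometric_iso_approximation :
  isometric_iso_onto_dual (@topological_dual_norm R E) (closed_span f)
    (fun y : E => `|y|) (E_sub f C) (fun psi y => psi y) ->
  approximation_property f C.
Proof.
move=> [_ _ iso _] x.
have /choice[y yP] : forall j : nat, exists y : E, E_sub f C y /\ `|y| <= `|x| /\
    forall i : 'I_j, `|f i x - f i y| < j.+1%:R^-1.
  move=> j.
  have [||y Cy [yx yf]] := @helly R E _ (E_sub_linear f_dual f_norming C_predual)
      j (fun i => f i) x j.+1%:R^-1 (fun i => f_dual i); last by exists y.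
  - move=> a; rewrite iso //; apply: lin_span_closed_span.
    by exists j, a, (fun i => f i); split=> // i; exists i.
  - by rewrite invr_gt0.
exists y; split=> [j||]; first exact: (yP j).1.
- apply/sigma_cvgP => n; apply/cvgrPdist_lt => e e0.
  near=> j; have nj : (n < j)%N by near: j; exact: nbhs_infty_gt.
  apply: lt_trans ((yP j).2.2 (Ordinal nj)) _.
  by near: j; exact: near_infty_natSinv_lt (PosNum e0).
- by exists `|x| => _ [j _ <-]; exact: (yP j).2.1.
Unshelve. all: by end_near. Qed.

End Converse.

Unset Implicit Arguments.
Set Strict Implicit.

Theorem theorem3p3 (R : realType) (E : completeNormedModType R)
    (f : nat -> E -> R^o) (C : set (nat -> R^o))
    (f_dual : forall n, topological_dual (f n))
    (f_norming : norming f)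
    (f_predual : generates_predual f)
    (C_predual : isometric_predual_l1 C) :
  approximation_property f C <->
  isometric_iso_onto_dual
    (@topological_dual_norm R E) (closed_span f)
    (fun y : E => `|y|) (E_sub f C)
    (fun (psi : E -> R^o) (y : E) => psi y).
Proof.
split; first exact: approximation_isometric_iso.
exact: isometric_iso_approximation.
Qed.
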